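(* Let $p$ be a prime, let $U$ be a uniform pro-$p$ group, and let $G$ be a (not necessarily closed) subgroup of $U$. If $G$ is virtually abelian, then $G$ is abelian.
   Context: A pro-$p$ group $U$ is powerful if $U/\overline{U^p}$ is abelian (for $p$ odd), respectively $U/\overline{U^4}$ is abelian (for $p=2$), where $\overline{U^k}$ is the closure of the subgroup generated by $k$-th powers. A pro-$p$ group $U$ is uniform if it is topologically finitely generated, powerful, and $|P_i(U):P_{i+1}(U)| = |U:P_2(U)|$ for all $i \ge 1$, where $P_1(U)=U$ and $P_{i+1}(U)=\overline{P_i(U)^p[P_i(U),U]}$. (Equivalently: $U$ is topologically finitely generated, powerful and torsion free.) A group is virtually abelian if it has an abelian subgroup of finite index. *)

(* Defs.v *)
From HB Require Import structures.
From mathcomp Require Import all_boot.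
From mathcomp Require Import all_classical.
From mathcomp Require Import topology.

Set Implicit Arguments.
Unset Strict Implicit.
Unset Printing Implicit Defensive.

Local Open Scope classical_set_scope.
Local Open Scope card_scope.
Local Open Scope group_scope.

HB.mixin Record isTopologicalGroup U of Topological U & Group U := {
  mulg_continuous : continuous (fun x : U * U => x.1 * x.2) ;
  invg_continuous : continuous (fun x : U => x^-1)
}.

#[short(type="topologicalGroupType")]
HB.structure Definition TopologicalGroup :=
  {U of Topological U & Group U & isTopologicalGroup U}.

Section AbstractGroups.
Variable U : groupType.
Implicit Types A B H K : set U.

Definition subgroup H : Prop := group_closed (mem H).

Definition normal_subgroup H : Prop :=
  subgroup H /\ forall x y, H x -> H (x ^ y).

Definition abelian H : Prop := forall x y, H x -> H y -> commute x y.

Definition generated A : set U := smallest subgroup A.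

Definition mulset A B : set U := [set x * y | x in A & y in B].

(* The left cosets of H by elements of K; for subgroups H `<=` K, the
   cardinality of this set is the index |K : H|. *)
Definition lcosets K H : set (set U) := [set mulset [set x] H | x in K].

(* U / H is abelian, for a normal subgroup H; the product of two cosets in the
   quotient is their product as subsets of U. *)
Definition quotient_abelian H : Prop :=
  forall A B, lcosets setT H A -> lcosets setT H B -> mulset A B = mulset B A.

Definition power_subgroup k H : set U := generated [set x ^+ k | x in H].

Definition commutator_subgroup H K : set U :=
  generated [set [~ x, y] | x in H & y in K].

Definition virtually_abelian H : Prop :=
  exists A, [/\ subgroup A, A `<=` H, abelian A & finite_set (lcosets H A)].

End AbstractGroups.

Section ProPGroups.
Variables (p : nat) (U : topologicalGroupType).

(* A profinite group is a compact Hausdorff topological group whose open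
   subgroups form a base of neighbourhoods of the identity. *)
Definition profinite : Prop :=
  [/\ compact [set: U], hausdorff_space U &
      forall B : set U, nbhs 1 B ->
        exists H, [/\ subgroup H, open H & H `<=` B]].

Definition pro_p : Prop :=
  profinite /\
  forall H : set U, normal_subgroup H -> open H ->
    exists n, lcosets setT H #= `I_(p ^ n)%N.

Definition powerful : Prop :=
  quotient_abelian
    (closure (power_subgroup (if p == 2 then 4 else p) [set: U])).

Definition topologically_finitely_generated : Prop :=
  exists A : set U, finite_set A /\ closure (generated A) = setT.

(* The series is indexed from 1: P_1 = U; the term of index 0 is a dummy. *)
Definition lower_p_series (i : nat) : set U :=
  iter i.-1 (fun P => closure (mulset (power_subgroup p P)
                                      (commutator_subgroup P setT))) setT.

Definition uniform : Prop :=
  [/\ topologically_finitely_generated, powerful &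
      forall i, (1 <= i)%N ->
        lcosets (lower_p_series i) (lower_p_series i.+1)
          #= lcosets setT (lower_p_series 2)].

End ProPGroups.

(* Main.v *)
(* In a uniform group U, the congruence (x z)^p = x^p z^p mod P_(i+2) for x in U
   and z in P_i shows that z |-> z^p induces a homomorphism from P_i / P_(i+1)
   to P_(i+1) / P_(i+2). It is onto since U is powerful, hence injective since
   both finite groups have the same order. If x^p = y^p with y = x z, the same
   congruence then pushes z down the series, whose intersection is trivial, so
   p-th roots are unique in U; n-th roots for n prime to p are unique because
   they are so in finite p-groups. Finally, if x^n and y^m lie in an abelian
   subgroup, then x^n is the n-th power of both x and its conjugate by y^m, so x
   commutes with y^m, and likewise with y. *)
From mathcomp Require Import all_boot all_fingroup all_solvable.
From mathcomp Require Import finmap.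
From mathcomp Require Import all_classical.
From mathcomp Require Import topology.
(* Defs is imported last: all_fingroup also defines abelian, generated, ... *)
Require Import Defs.

Set Implicit Arguments.
Unset Strict Implicit.
Unset Printing Implicit Defensive.

Local Open Scope classical_set_scope.
Local Open Scope card_scope.
Local Open Scope group_scope.

(** * Subgroups, cosets and commutators in an abstract group *)

Section Subgroups.
Variable U : groupType.
Implicit Types (A B H K N P : set U) (x y z : U).

Lemma subgroupP H :
  subgroup H <-> H 1 /\ forall x y, H x -> H y -> H (x * y^-1).
Proof.
rewrite /subgroup /group_closed; split=> -[H1 HV]; split.
- by rewrite inE in H1.
- by move=> x y Hx Hy; have := HV x y; rewrite !inE; exact.
- by rewrite inE.
- by move=> x y; rewrite !inE; exact: HV.
Qed.

Lemma subgroup1 H : subgroup H -> H 1.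
Proof. by case/subgroupP. Qed.

Lemma subgroupV H x : subgroup H -> H x -> H x^-1.
Proof. by case/subgroupP => H1 HV Hx; rewrite -(mul1g x^-1); exact: HV. Qed.

Lemma subgroupM H x y : subgroup H -> H x -> H y -> H (x * y).
Proof.
move=> sH Hx Hy; rewrite -(invgK y); case/subgroupP: (sH) => _; apply=> //.
exact: subgroupV.
Qed.

Lemma subgroupX H x n : subgroup H -> H x -> H (x ^+ n).
Proof.
move=> sH Hx; elim: n => [|n IH]; first exact: subgroup1.
by rewrite expgS; exact: subgroupM.
Qed.

Lemma normalR N x y : normal_subgroup N -> N x -> N [~ x, y].
Proof.
by move=> [sN nN] Nx; apply: subgroupM => //; [exact: subgroupV | exact: nN].
Qed.

Lemma subgroupT : subgroup [set: U].
Proof. by apply/subgroupP. Qed.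

Lemma normal_subgroupT : normal_subgroup [set: U].
Proof. by split=> //; exact: subgroupT. Qed.

Lemma generated_subgroup A : subgroup (generated A).
Proof.
apply/subgroupP; split=> [B [sB _]|x y Ax Ay B BA]; first exact: subgroup1.
have [sB _] := BA; apply: subgroupM => //; first exact: Ax.
by apply: subgroupV => //; exact: Ay.
Qed.

Lemma sub_generated A : A `<=` generated A.
Proof. exact: sub_smallest. Qed.

Lemma generated_min A H : subgroup H -> A `<=` H -> generated A `<=` H.
Proof. exact: smallest_sub. Qed.

Lemma generated_normal A :
  (forall x y, A x -> A (x ^ y)) -> normal_subgroup (generated A).
Proof.
move=> AJ; split=> [|x y]; first exact: generated_subgroup.
apply: (@generated_min A [set x | generated A (x ^ y)]).
  apply/subgroupP; split => [|u v /= Au Av].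
    by rewrite /= conj1g; apply: subgroup1; exact: generated_subgroup.
  rewrite conjMg conjVg; case/subgroupP: (generated_subgroup A) => _.
  exact.
by move=> u Au; apply: sub_generated; exact: AJ.
Qed.

Lemma power_subgroup_normal n N :
  normal_subgroup N -> normal_subgroup (power_subgroup n N).
Proof.
case=> _ nN; apply: generated_normal => _ y [x Nx <-].
by exists (x ^ y); [exact: nN | rewrite conjXg].
Qed.

Lemma commutator_subgroup_normal N K : normal_subgroup N -> normal_subgroup K ->
  normal_subgroup (commutator_subgroup N K).
Proof.
move=> [_ nN] [_ nK]; apply: generated_normal => _ z [x Nx [y Ky <-]].
by exists (x ^ z); [exact: nN | exists (y ^ z); [exact: nK | rewrite conjRg]].
Qed.

Lemma mulset_normal N K : normal_subgroup N -> normal_subgroup K ->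
  normal_subgroup (mulset N K).
Proof.
move=> [sN nN] [sK nK]; split; last first.
  move=> _ z [x Nx [y Ky <-]].
  by exists (x ^ z); [exact: nN | exists (y ^ z); [exact: nK | rewrite conjMg]].
apply/subgroupP; split.
  by exists 1; [exact: subgroup1|exists 1; [exact: subgroup1|rewrite mulg1]].
move=> _ _ [x Nx [y Ky <-]] [u Nu [v Kv <-]].
(* Moving [u^-1] to the left across [y * v^-1] conjugates it by [v * y^-1]. *)
exists (x * (u^-1) ^ (v * y^-1)).
  by apply: subgroupM => //; apply: nN; exact: subgroupV.
exists (y * v^-1); first by apply: subgroupM => //; exact: subgroupV.
by rewrite conjgE !invgM invgK !mulgA !(mulgVK, mulgK).
Qed.

Lemma subset_mulsetl A K : K 1 -> A `<=` mulset A K.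
Proof. by move=> K1 x Ax; exists x => //; exists 1 => //; rewrite mulg1. Qed.

Lemma subset_mulsetr A K : A 1 -> K `<=` mulset A K.
Proof. by move=> A1 x Kx; exists 1 => //; exists x => //; rewrite mul1g. Qed.

Lemma mem_coset H x y : mulset [set x] H y <-> H (x^-1 * y).
Proof.
split=> [[_ -> [h Hh <-]]|Hxy]; first by rewrite mulKg.
by exists x => //; exists (x^-1 * y) => //; rewrite mulVKg.
Qed.

Lemma eq_coset H x y : subgroup H ->
  mulset [set x] H = mulset [set y] H <-> H (x^-1 * y).
Proof.
move=> sH; split=> [e|Hxy].
  by apply/mem_coset; rewrite e; apply/mem_coset; rewrite mulVg;
     exact: subgroup1.
apply/seteqP; split=> z /mem_coset Hz; apply/mem_coset.
  have -> : y^-1 * z = (x^-1 * y)^-1 * (x^-1 * z).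
    by rewrite invgM invgK mulgA mulgK.
  by apply: subgroupM => //; exact: subgroupV.
have -> : x^-1 * z = (x^-1 * y) * (y^-1 * z) by rewrite mulgA mulgK.
exact: subgroupM.
Qed.

Lemma lcosets_sub H K K' : K `<=` K' -> lcosets K H `<=` lcosets K' H.
Proof. by move=> KK' _ [x /KK' K'x <-]; exists x. Qed.

(** Since [x * y] lies in $yN \cdot xN$, it equals [y * h * (x * k)] with [h] and [k] in [N], whence
    [[~ x, y] = h ^ x * k]. *)
Lemma quotient_abelianR N x y :
  normal_subgroup N -> quotient_abelian N -> N [~ x, y].
Proof.
move=> [sN nN] /(_ (mulset [set x] N) (mulset [set y] N)) e.
have Nmem z : mulset [set z] N z.
  by apply/mem_coset; rewrite mulVg; exact: subgroup1.
have : mulset (mulset [set x] N) (mulset [set y] N) (x * y).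
  by exists x; [exact: Nmem | exists y; [exact: Nmem|]].
rewrite e; [|by exists x|by exists y].
move=> [_ [_ -> [h Nh <-]] [_ [_ -> [k Nk <-]] exy]].
have -> : [~ x, y] = h ^ x * k.
  by rewrite commgEl !conjgE -exy -!mulgA mulKg.
by apply: subgroupM => //; exact: nN.
Qed.

(** Pigeonhole: were no positive power of [x] in [H], the cosets $x^n H$ would be pairwise
    distinct. *)
Lemma finite_index_expn H K x : subgroup H -> subgroup K ->
  finite_set (lcosets K H) -> K x -> exists2 n, (0 < n)%N & H (x ^+ n).
Proof.
move=> sH sK finKH Kx; apply: contrapT => noexp; apply: infinite_nat.
pose c n := mulset [set x ^+ n] H.
have inj_c : {in [set: nat] &, injective c}.
  have inj_lt i j : (i < j)%N -> c i <> c j.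
    move=> ij /eq_coset-/(_ sH) Hij; apply: noexp; exists (j - i)%N.
      by rewrite subn_gt0.
    by rewrite -(mulKg (x ^+ i) (_ ^+ (j - i))) -expgnDr subnKC // ltnW.
  move=> i j _ _ cij; have [/inj_lt//|/inj_lt/nesym//|//] := ltngtP i j.
rewrite -(eq_finite_set (inj_card_eq inj_c)); apply: sub_finite_set finKH.
by move=> _ [n _ <-]; exists (x ^+ n) => //; exact: subgroupX.
Qed.

End Subgroups.

(** * Commutator identities and congruences modulo a normal subgroup *)

Lemma commMgl (U : groupType) (x y z : U) :
  [~ x * y, z] = [~ x, z] ^ y * [~ y, z].
Proof. 
rewrite !commgEl conjMg (conjgE (_ * _) y) invgM.
by move: (x ^ z) (y ^ z) => a b; rewrite -!mulgA mulVKg.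
Qed.

Lemma commVgl (U : groupType) (x z : U) : [~ x^-1, z] = ([~ x, z] ^ x^-1)^-1.
Proof.
apply: (mulgI ([~ x, z] ^ x^-1)); rewrite mulgV.
by rewrite -commMgl mulgV comm1g.
Qed.

Lemma conjg_commg (U : groupType) (x y : U) : x ^ y = x * [~ x, y].
Proof. by rewrite commgEl mulVKg. Qed.

Section Congruence.
Variables (U : groupType) (N : set U).
Hypothesis nN : normal_subgroup N.
Implicit Types x y z : U.

Let sN : subgroup N := nN.1.

Definition eqmod x y := N (x^-1 * y).

Lemma eqmod_refl x : eqmod x x.
Proof. by rewrite /eqmod mulVg; exact: subgroup1. Qed.

Lemma eqmod_trans y x z : eqmod x y -> eqmod y z -> eqmod x z.
Proof.
move=> xy yz; rewrite /eqmod; have -> : x^-1 * z = (x^-1 * y) * (y^-1 * z).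
  by rewrite mulgA mulgK.
exact: subgroupM.
Qed.

Lemma eqmod_sym x y : eqmod x y -> eqmod y x.
Proof. by move=> /(subgroupV sN); rewrite invgM invgK. Qed.

Lemma eqmodV x y : eqmod x y -> eqmod x^-1 y^-1.
Proof.
move=> /(subgroupV sN)/(nN.2 _ x^-1).
by rewrite /eqmod conjgE !invgM !invgK -!mulgA mulgV mulg1.
Qed.

Lemma eqmodMl z x y : eqmod x y -> eqmod (z * x) (z * y).
Proof. by rewrite /eqmod invgM -mulgA mulKg. Qed.

Lemma eqmodMr z x y : eqmod x y -> eqmod (x * z) (y * z).
Proof. by move=> /(nN.2 _ z); rewrite /eqmod conjgE invgM !mulgA. Qed.

Lemma eqmod1 x : eqmod 1 x <-> N x.
Proof. by rewrite /eqmod invg1 mul1g. Qed.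

Lemma eqmodMgr x y : N y -> eqmod x (x * y).
Proof. by rewrite /eqmod mulKg. Qed.

Lemma eqmod_commute x y : N [~ x, y] -> eqmod (y * x) (x * y).
Proof. by rewrite /eqmod invgM commgEl conjgE -!mulgA. Qed.

(** Collection: modulo [N] the commutator [c = [~ z, x]] is central, so [(x * z) ^+ n] is congruent
    to [x ^+ n * z ^+ n * c ^+ 'C(n, 2)]. *)
Lemma eqmod_expMg x z n : (forall u, N [~ [~ z, x], u]) ->
  N ([~ z, x] ^+ 'C(n, 2)) -> eqmod ((x * z) ^+ n) (x ^+ n * z ^+ n).
Proof.
move: [~ z, x] (commgC z x) => c zxE cN cbin.
have cC u k : eqmod (c ^+ k * u) (u * c ^+ k).
  apply: eqmod_sym; elim: k => [|k IH].
    by rewrite expg0 mul1g mulg1; exact: eqmod_refl.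
  rewrite expgS -mulgA; apply: (eqmod_trans _ (eqmodMl _ IH)).
  by rewrite !mulgA; apply: eqmodMr; apply: eqmod_commute.
(* Each of the [k] factors [z] that [x] crosses leaves one [c]. *)
have zx k : eqmod (z ^+ k * x) (x * z ^+ k * c ^+ k).
  elim: k => [|k IH]; first by rewrite !expg0 mul1g !mulg1; exact: eqmod_refl.
  rewrite expgSr -mulgA zxE !mulgA.
  apply: (eqmod_trans (eqmodMr _ (eqmodMr _ IH)) _).
  rewrite (expgSr c) !mulgA; apply: eqmodMr.
  by rewrite -!mulgA; do 2!apply: eqmodMl.
(* The new [x] crosses [z ^+ k], which raises the exponent of [c] by [k], as in Pascal's rule. *)
have xz k : eqmod ((x * z) ^+ k) (x ^+ k * z ^+ k * c ^+ 'C(k, 2)).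
  elim: k => [|k IH]; first by rewrite !expg0 !mulg1; exact: eqmod_refl.
  rewrite expgSr; apply: (eqmod_trans (eqmodMr _ IH) _).
  rewrite -[_ * c ^+ _ * _]mulgA.
  apply: (eqmod_trans (eqmodMl _ (cC (x * z) _)) _).
  rewrite binS bin1 addnC expgnDr !mulgA; apply: eqmodMr.
  rewrite -(mulgA (x ^+ k)).
  apply: (eqmod_trans (eqmodMr _ (eqmodMl _ (zx k))) _).
  rewrite (expgSr z) (expgSr x) -!mulgA; do 3!apply: eqmodMl.
  exact: cC.
apply: (eqmod_trans (xz n) _); apply: eqmod_sym; exact: eqmodMgr.
Qed.

End Congruence.

(** * Quotients of finite index as finite groups *)

Section FiniteQuotient.
Variables (U : groupType) (N : set U) (m : nat).
Hypotheses (nN : normal_subgroup N) (Nm : lcosets setT N #= `I_m).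

(* The quotient is realized by the permutations that right translations induce
   on a set of indices of the cosets. *)
Lemma finite_quotient :
  exists (gT : finGroupType) (G : {group gT}) (f : U -> gT),
  [/\ {morph f : x y / x * y}, forall x, f x = 1 <-> N x,
      forall x, f x \in G, forall g, g \in G -> exists x, f x = g & #|G| = m].
Proof.
have sN := nN.1.
have [c bij_c] := card_set_bijP Nm.
pose k x := c (mulset [set x] N).
have kP x y : k x = k y <-> N (x^-1 * y).
  rewrite -eq_coset //; split=> [|e]; last by rewrite /k e.
  by apply: (set_bij_inj bij_c); rewrite inE; eexists.
have k_lt x : (k x < m)%N.
  by have := set_bij_homo bij_c; apply; exists x.
pose K x := Ordinal (k_lt x).
have KP x y : K x = K y <-> N (x^-1 * y).
  by rewrite -kP; split=> [[]|e] //; exact: val_inj.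
have K_surj (i : 'I_m) : exists x, K x = i.
  have [_ [x _ <-] e] := set_bij_surj bij_c (ltn_ord i).
  by exists x; exact: val_inj.
have [r rK] := choice K_surj.
have KM x y z : K x = K y -> K (x * z) = K (y * z).
  move=> /KP /nN.2-/(_ z) Nz; apply/KP.
  by rewrite invgM -mulgA (mulgA x^-1).
have KMl x y z : K x = K y -> K (z * x) = K (z * y).
  by move=> /KP Nxy; apply/KP; rewrite invgM -mulgA mulKg.
have inj_rho x : injective (fun i => K (r i * x)).
  by move=> i j /KM-/(_ x^-1); rewrite !mulgK !rK.
(* Permutations compose from left to right, so right translations give a morphism. *)
pose f x := perm (inj_rho x).
have fM : {morph f : x y / x * y}.
  move=> x y; apply/permP=> i; rewrite permM !permE mulgA.
  by apply: KM; rewrite rK.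
(* The permutation [f x] determines the coset of [x], since it sends [K 1] to [K x]. *)
have fE x y : f x = f y <-> K x = K y.
  split=> [/permP/(_ (K 1))|e]; last first.
    by apply/permP=> i; rewrite !permE; exact: KMl.
  have r1 z : K (r (K 1) * z) = K z by rewrite -[in RHS](mul1g z); apply/KM/rK.
  by rewrite !permE !r1.
pose G := [set s | `[< exists x, f x = s >]]%SET.
have GP s : reflect (exists x, f x = s) (s \in G).
  by rewrite inE; exact: asboolP.
have fG x : f x \in G by apply/GP; exists x.
have f1 : f 1 = 1.
  by apply: (mulgI (f 1)); rewrite -fM !mulg1.
have gG : group_set G.
  apply/group_setP; split; first by rewrite -f1.
  by move=> _ _ /GP[x <-] /GP[y <-]; rewrite -fM.
exists _, (Group gG), f; split=> //.
- move=> x; rewrite -f1 fE KP mulg1.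
  by split=> /(subgroupV sN); rewrite ?invgK.
- by move=> s /GP.
have inj_fr : injective (f \o r) by move=> i j /fE; rewrite !rK.
apply: etrans (etrans (card_imset 'I_m inj_fr) (card_ord m)).
apply: eq_card => s; apply/GP/imsetP => [[x <-]|[i _ ->]]; last by exists (r i).
by exists (K x) => //=; apply/fE; rewrite rK.
Qed.

End FiniteQuotient.

(** * Closures, open subgroups and finite index in topological groups *)

Section TopologicalGroups.
Variable U : topologicalGroupType.
Implicit Types (A B H K N P S : set U) (x y z : U).

Lemma cvg_mulg (T : Type) (F : set_system T) (f g : T -> U) x y : Filter F ->
  f @ F --> x -> g @ F --> y -> (fun t => f t * g t) @ F --> x * y.
Proof.
by move=> FF; apply: continuous2_cvg; exact: (@mulg_continuous U (x, y)).
Qed.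

Lemma continuous_mulgl x : continuous (fun y => x * y).
Proof. by move=> y; apply: cvg_mulg; [exact: cvg_cst | exact: cvg_id]. Qed.

Lemma continuous_mulgr x : continuous (fun y => y * x).
Proof. by move=> y; apply: cvg_mulg; [exact: cvg_id | exact: cvg_cst]. Qed.

Lemma continuous_conjg x : continuous (fun y => y ^ x).
Proof.
move=> y; rewrite /conjg; apply: cvg_mulg; first exact: cvg_cst.
by apply: cvg_mulg; [exact: cvg_id | exact: cvg_cst].
Qed.

Lemma continuous_commg x : continuous (fun y => [~ y, x]).
Proof.
move=> y; rewrite /commg; apply: cvg_mulg; first exact: invg_continuous.
exact: continuous_conjg.
Qed.

Lemma closure_min A B : closed B -> A `<=` B -> closure A `<=` B.
Proof. by move=> + AB => /closure_id ->; exact: closureS. Qed.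

Lemma closure_subgroup H : subgroup H -> subgroup (closure H).
Proof.
move=> sH; have cl := @closed_closure _ H.
have HV y : closure H y -> closure H y^-1.
  have /continuous_closedP/(_ _ cl) clV := @invg_continuous U.
  by apply: (closure_min clV) => x Hx; apply: subset_closure; exact: subgroupV.
(* One variable at a time: closed preimages under translations reduce to [x] in [H], then to [y] in
   [H]. *)
have HM x y : closure H x -> closure H y -> closure H (x * y).
  move=> + Hy; move: x.
  have /continuous_closedP/(_ _ cl) clr := @continuous_mulgr y.
  apply: (closure_min clr) => x Hx; move: y Hy {clr}.
  have /continuous_closedP/(_ _ cl) cll := @continuous_mulgl x.
  apply: (closure_min cll) => y Hy.
  by apply: subset_closure; exact: subgroupM.
apply/subgroupP; split; first by apply: subset_closure; exact: subgroup1.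
by move=> x y Hx /HV; exact: HM.
Qed.

Lemma closure_normal N : normal_subgroup N -> normal_subgroup (closure N).
Proof.
move=> [sN nN]; split; first exact: closure_subgroup.
move=> x y; move: x.
have /continuous_closedP/(_ _ (@closed_closure _ N)) cl := @continuous_conjg y.
by apply: (closure_min cl) => x Nx; apply: subset_closure; exact: nN.
Qed.

Lemma closed_coset H x : closed H -> closed (mulset [set x] H).
Proof.
move=> cH; have -> : mulset [set x] H = (fun y => x^-1 * y) @^-1` H.
  by apply/seteqP; split=> y /mem_coset.
by have /continuous_closedP := @continuous_mulgl x^-1; exact.
Qed.

Lemma subgroup_open H : subgroup H -> nbhs 1 H -> open H.
Proof.
move=> sH H1; rewrite openE => x Hx; rewrite /interior.
have : nbhs x ((fun y => x^-1 * y) @^-1` H).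
  by apply: continuous_mulgl; rewrite mulVg.
apply: filterS => y /(subgroupM sH Hx).
by rewrite mulVKg.
Qed.

Lemma subgroup_open_sub H K : open H -> subgroup H -> subgroup K -> H `<=` K ->
  open K.
Proof.
move=> oH sH sK HK; apply: subgroup_open => //; apply: filterS HK _.
by apply: open_nbhs_nbhs; split => //; exact: subgroup1.
Qed.

(** A point [x] of the closure has the neighbourhood $xH$, which meets [H] only if [x] lies in
    [H]. *)
Lemma open_subgroup_closed H : open H -> subgroup H -> closed H.
Proof.
move=> oH sH x clHx.
have nHx : nbhs x ((fun y => x^-1 * y) @^-1` H).
  apply: continuous_mulgl; rewrite mulVg.
  by apply: open_nbhs_nbhs; split => //; exact: subgroup1.
have [y [Hy /= Hxy]] := clHx _ nHx.
have -> : x = y * (x^-1 * y)^-1 by rewrite invgM invgK mulVKg.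
by apply: subgroupM => //; exact: subgroupV.
Qed.

(** [K] is a finite union of translates of the closed set [H]. *)
Lemma finite_index_closed K H : subgroup K -> subgroup H -> H `<=` K ->
  closed H -> finite_set (lcosets K H) -> closed K.
Proof.
move=> sK sH HK cH fin.
have -> : K = \bigcup_(C in lcosets K H) C.
  apply/seteqP; split=> [x Kx|x [_ [y Ky <-] /mem_coset Hyx]].
    exists (mulset [set x] H); first by exists x.
    by apply/mem_coset; rewrite mulVg; exact: subgroup1.
  by rewrite -(mulVKg y x); apply: subgroupM => //; exact: HK.
by apply: closed_bigcup => // _ [x Kx <-]; exact: closed_coset.
Qed.

(** The witness is the normal core of [H]. Conjugation is jointly continuous at each [(g, 1)], and
    compactness yields one neighbourhood of [1] that works for all [g]. *)
Lemma compact_open_core H : compact [set: U] -> subgroup H -> open H ->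
  exists N, [/\ normal_subgroup N, open N & N `<=` H].
Proof.
move=> cptU sH oH; exists [set x | forall g, H (x ^ g)].
have sN : subgroup [set x | forall g, H (x ^ g)].
  apply/subgroupP; split=> [g|x y Hx Hy g].
    by rewrite conj1g; exact: subgroup1.
  by rewrite conjMg conjVg; apply: subgroupM => //; exact: subgroupV.
split; last by move=> x /(_ 1); rewrite conjg1.
  by split=> // x y Hx g; rewrite -conjgM.
apply: subgroup_open => //.
have H1 : nbhs 1 H by apply: open_nbhs_nbhs; split => //; exact: subgroup1.
have cvgJ (g : U) : (fun z : U * U => z.2 ^ z.1) @ (g, 1) --> (1 : U).
  suff : (fun z : U * U => z.2 ^ z.1) @ (g, 1) --> g^-1 * (1 * g).
    by rewrite mul1g mulVg.
  apply: cvg_mulg.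
    apply: cvg_comp; first exact: cvg_fst.
    exact: (@invg_continuous U g).
  by apply: cvg_mulg; [exact: cvg_snd | exact: cvg_fst].
have := compact_near_coveringP [set: U]; case=> /(_ cptU) cover _.
have := cover U (nbhs 1) (fun x g => H (x ^ g)) (nbhs_filter _)
  (fun g _ => cvgJ g _ H1).
by apply: filterS => x Hx g; exact: Hx.
Qed.

(** The quotient by [N] is abelian of exponent dividing [p], so [K] and [a] generate the union of
    the cosets $a^e K$ with $e < p$. *)
Lemma finite_index_extend p N K a : (0 < p)%N -> normal_subgroup N ->
  (forall x y, N [~ x, y]) -> (forall x, N (x ^+ p)) ->
  subgroup K -> N `<=` K -> finite_set (lcosets K N) ->
  exists K', [/\ subgroup K', K `<=` K', K' a & finite_set (lcosets K' N)].
Proof.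
move=> p0 [sN nN] NR NX sK NK fin.
have KJ x y : K x -> K (x ^ y).
  by move=> Kx; rewrite conjg_commg; apply: subgroupM => //; exact: NK.
have KXp x n : K (x ^+ (p * n)).
  by rewrite expgnA; apply: subgroupX => //; exact: NK.
exists [set x | exists e, K ((a ^+ e)^-1 * x)]; split.
- apply/subgroupP; split=> [|x y [e Kx] [f Ky]].
    by exists 0; rewrite expg0 invg1 mulg1; exact: subgroup1.
  (* Exponents are natural numbers, so [p.-1] stands for $-1$: [a ^+ p] lies in [N], hence in
     [K]. *)
  exists (e + f * p.-1)%N.
  pose m := ((a ^+ e)^-1 * x) * ((a ^+ f)^-1 * y)^-1.
  have Km : K m by apply: subgroupM => //; exact: subgroupV.
  suff -> : (a ^+ (e + f * p.-1))^-1 * (x * y^-1)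
              = (a ^+ (p * f))^-1 * m ^ (a ^+ f)^-1.
    by apply: subgroupM; [|exact: subgroupV|exact: KJ].
  have aE : a ^+ (p * f) = a ^+ f * a ^+ (f * p.-1).
    by rewrite -expgnDr -mulnS prednK // mulnC.
  rewrite expgnDr aE /m conjgE !invgM !invgK -!mulgA mulKg mulgV mulg1.
  by [].
- by move=> x Kx; exists 0; rewrite expg0 invg1 mul1g.
- by exists 1%N; rewrite expg1 mulVg; exact: subgroup1.
pose F r C := mulset [set a ^+ r] C.
apply: sub_finite_set (finite_image2 F (finite_II p) fin).
move=> _ [x [e Kx] <-].
have Kr : K ((a ^+ (e %% p))^-1 * x).
  have -> : (a ^+ (e %% p))^-1 * x = a ^+ (p * (e %/ p)) * ((a ^+ e)^-1 * x).
    have -> : a ^+ e = a ^+ (e %% p) * a ^+ (p * (e %/ p)).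
      by rewrite -expgnDr addnC mulnC -divn_eq.
    by rewrite invgM -mulgA mulVKg.
  exact: subgroupM.
exists (e %% p)%N; first exact: ltn_pmod.
exists (mulset [set (a ^+ (e %% p))^-1 * x] N).
  by exists ((a ^+ (e %% p))^-1 * x).
set b := a ^+ _ in Kr *.
apply/seteqP; split=> y.
  move=> [_ -> [z /mem_coset + <-]].
  by rewrite invgM invgK -mulgA => /mem_coset.
move=> /mem_coset Ny; apply/mem_coset; apply/mem_coset.
by rewrite invgM invgK -mulgA mulVKg.
Qed.

(** Adjoining the generators one by one to [N] gives a subgroup that is a finite union of cosets of
    [N]. It is closed and contains a dense subgroup, so it is the whole group. *)
Lemma tfg_finite_index p N : (0 < p)%N -> normal_subgroup N -> closed N ->
  (forall x y, N [~ x, y]) -> (forall x, N (x ^+ p)) ->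
  topologically_finitely_generated U -> finite_set (lcosets setT N).
Proof.
move=> p0 nN cN NR NX [A [/finite_seqP[s ->] denseA]].
suff [K [sK NK sub fin]] : exists K, [/\ subgroup K, N `<=` K,
    [set` s] `<=` K & finite_set (lcosets K N)].
  suff <- : K = setT by [].
  apply/seteqP; split=> // x _.
  have cK : closed K by exact: (finite_index_closed _ nN.1).
  have : closure (generated [set` s]) x by rewrite denseA.
  by apply: (closure_min cK); apply: generated_min.
elim: s {denseA} => [|a s [K [sK NK sub fin]]].
  exists N; split=> //; first exact: nN.1.
  apply: sub_finite_set (finite_set1 N) => _ [x Nx <-].
  apply/seteqP; split=> y; rewrite mem_coset => Ny.
    by rewrite -(mulVKg x y); apply: subgroupM => //; exact: nN.1.
  apply: subgroupM => //; first exact: nN.1.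
  by apply: subgroupV => //; exact: nN.1.
have [K' [sK' KK' K'a fin']] := finite_index_extend a p0 nN NR NX sK NK fin.
exists K'; split=> //; first by move=> x /NK /KK'.
by move=> x /=; rewrite inE => /orP[/eqP->//|/sub/KK'].
Qed.

End TopologicalGroups.

(** * The lower $p$-series of a pro-$p$ group *)

(** By nilpotency $[K, G]$ is proper in [K]. A maximal subgroup [M] of [K] above it is normal in
    [G], and it contains the $p$-th powers because it contains the Frattini subgroup of [K]. *)
Lemma pgroup_proper_normal (gT : finGroupType) (p : nat) (G K : {group gT}) :
  p.-group G -> K <| G -> K :!=: [1 gT] ->
  exists M : {group gT}, [/\ M <| G, M \proper K,
    {in K, forall x, x ^+ p \in M} & {in K & G, forall x y, [~ x, y] \in M}].
Proof.
move=> pG nKG K1; have pK := pgroupS (normal_sub nKG) pG.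
have prop : [~: K, G] \proper K.
  apply: (nil_comm_properl (pgroup_nil pG)) (normal_sub nKG) K1 _.
  by rewrite finset.subsetI fintype.subxx normal_norm.
have [e|[M maxM sM]] := maximal_exists (fintype.proper_sub prop).
  by rewrite e fintype.properxx in prop.
have MK : M \proper K := maxgroupp maxM.
exists M; split=> //.
- have sMG := fintype.subset_trans (fintype.proper_sub MK) (normal_sub nKG).
  rewrite /normal sMG /=.
  by rewrite -commg_subl (fintype.subset_trans _ sM) // commSg // proper_sub.
- move=> x Kx; apply: (fintype.subsetP (Phi_sub_max maxM)).
  rewrite (Phi_joing pK).
  apply: (fintype.subsetP (joing_subr _ _)); rewrite -[p in _ ^+ p]expn1.
  by apply: Mho_p_elt => //; exact: mem_p_elt Kx.
- by move=> x y Kx Gy; apply: (fintype.subsetP sM); exact: mem_commg.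
Qed.

Section LowerPSeries.
Variables (p : nat) (U : topologicalGroupType).
Implicit Types (N K : set U) (x y z w : U) (n : nat).

(** [L n] is $P_{n+1}(U)$: the shift skips the dummy index, and inductions start at $P_1(U) = U$. *)
Local Notation L n := (@lower_p_series p U n.+1).

Lemma lower_p_seriesS n :
  L n.+1 = closure (mulset (power_subgroup p (L n))
                           (commutator_subgroup (L n) setT)).
Proof. by []. Qed.

Lemma lower_p_series_normal n : normal_subgroup (L n).
Proof.
elim: n => [|n IH]; first exact: normal_subgroupT.
rewrite lower_p_seriesS; apply: closure_normal; apply: mulset_normal.
  exact: power_subgroup_normal.
by apply: commutator_subgroup_normal => //; exact: normal_subgroupT.
Qed.

Lemma lower_p_series_closed n : closed (L n).
Proof. by case: n => [|n]; [exact: closedT | exact: closed_closure]. Qed.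

Lemma lower_p_seriesX n x : L n x -> L n.+1 (x ^+ p).
Proof.
move=> Lx; rewrite lower_p_seriesS; apply: subset_closure.
apply: subset_mulsetl; first by apply: subgroup1; exact: generated_subgroup.
by apply: sub_generated; exists x.
Qed.

Lemma lower_p_seriesR n x y : L n x -> L n.+1 [~ x, y].
Proof.
move=> Lx; rewrite lower_p_seriesS; apply: subset_closure.
apply: subset_mulsetr; first by apply: subgroup1; exact: generated_subgroup.
by apply: sub_generated; exists x => //; exists y.
Qed.

(** Inclusions of a term of the series are reduced by this to $p$-th powers and commutators. *)
Lemma lower_p_series_min n K : closed K -> subgroup K ->
  (forall x, L n x -> K (x ^+ p)) -> (forall x y, L n x -> K [~ x, y]) ->
  L n.+1 `<=` K.
Proof.
move=> cK sK KX KR; rewrite lower_p_seriesS; apply: closure_min => //.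
move=> _ [x Px [y Cy <-]]; apply: subgroupM => //.
  by apply: generated_min Px => // _ [z Lz <-]; exact: KX.
by apply: generated_min Cy => // _ [z Lz [w _ <-]]; exact: KR.
Qed.

Lemma lower_p_series_decr n : L n.+1 `<=` L n.
Proof.
have [sL nL] := lower_p_series_normal n.
apply: lower_p_series_min => //; first exact: lower_p_series_closed.
  by move=> x; exact: subgroupX.
by move=> x y; exact: (normalR _ (lower_p_series_normal n)).
Qed.

Hypotheses (p_prime : prime p) (pro_pU : pro_p p U).

(** In the finite $p$-group $U/N$ the images of the series are trapped in ever smaller normal
    subgroups, until they are trivial. *)
Lemma lower_p_series_sub_open N : normal_subgroup N -> open N ->
  exists n, L n `<=` N.
Proof.
move=> nN oN; have [e Ne] := pro_pU.2 _ nN oN.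
have [gT [G [f [fM f1 fG _ cardG]]]] := finite_quotient nN Ne.
have pG : p.-group G by rewrite /pgroup cardG pnatX pnat_id.
have fm1 : f 1 = 1 by apply/f1; exact: subgroup1 nN.1.
have fV x : f x^-1 = (f x)^-1 by apply: (mulgI (f x)); rewrite -fM !mulgV.
(* Induction on a bound [m] for the order of [K]: each round replaces [K] by a proper subgroup and
   [n] by [n.+1]. *)
suff shrink m (K : {group gT}) : (#|K| <= m)%N -> K <| G ->
    (exists n, forall x, L n x -> f x \in K) -> exists n, L n `<=` N.
  by apply: (shrink _ G (leqnn _) (normal_refl G)); exists 0 => x _; exact: fG.
elim: m K => [|m IH] K; first by rewrite leqNgt cardG_gt0.
move=> Km nK [n LK]; have [K1|K1] := eqVneq (K : {set gT}) [1 gT].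
  by exists n => x /LK; rewrite K1 => /set1P/f1.
have [M [nM MK KX KR]] := pgroup_proper_normal pG nK K1.
apply: (IH M) => //; first by rewrite -ltnS (leq_trans (proper_card MK)).
have sM : subgroup [set x | f x \in M].
  apply/subgroupP; split=> [|x y /= Mx My]; first by rewrite /= fm1 group1.
  by rewrite fM fV groupM ?groupV.
exists n.+1; apply: (@lower_p_series_min n [set x | f x \in M]) => //.
(* The preimage of [M] contains the open subgroup [N], so it is open, hence closed. *)
- apply: open_subgroup_closed => //; apply: (subgroup_open_sub oN nN.1 sM).
  by move=> x /f1 /= ->; exact: group1.
- move=> x /LK /KX /=; suff -> : f (x ^+ p) = f x ^+ p by [].
  by elim: p => [|q IHq]; rewrite ?expg0 // !expgS fM IHq.
- move=> x y /LK Kx /=.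
  by rewrite !(commgEl, conjgE) !fM !fV; exact: (KR _ (f y) Kx (fG y)).
Qed.

(** Every neighbourhood of [1] contains an open normal subgroup, so such a [z] cannot be separated
    from [1]. *)
Lemma open_normal_separates z :
  (forall N, normal_subgroup N -> open N -> N z) -> z = 1.
Proof.
case: (pro_pU) => -[cptU hausU baseU] _ zN; apply/esym/hausU.
move=> A B A1 Bz; exists z; split; last exact: nbhs_singleton.
have [H [sH oH HA]] := baseU _ A1.
have [N [nN oN NH]] := compact_open_core cptU sH oH.
by apply: HA; apply: NH; exact: zN.
Qed.

(** In each finite quotient [n] is prime to the group order, so $n$-th powers can be inverted
    there. *)
Lemma expg_coprime_inj n x y : coprime p n -> x ^+ n = y ^+ n -> x = y.
Proof.
move=> pn exy; suff /(congr1 (mulg x)) : x^-1 * y = 1 by rewrite mulVKg mulg1.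
apply: open_normal_separates => N nN oN; have [e Ne] := pro_pU.2 _ nN oN.
have [gT [G [f [fM f1 fG _ cardG]]]] := finite_quotient nN Ne.
have fm1 : f 1 = 1 by apply/f1; exact: subgroup1 nN.1.
have fX u k : f (u ^+ k) = f u ^+ k.
  by elim: k => [|k IHk]; rewrite ?expg0 // !expgS fM IHk.
have cGn : coprime #|G| n by rewrite cardG coprimeXl.
have fxy : f x = f y.
  by rewrite -(expgK cGn (fG x)) -(expgK cGn (fG y)) /= -!fX exy.
by apply/f1; apply: (mulgI (f x)); rewrite -fM mulVKg fxy mulg1.
Qed.

End LowerPSeries.

(** * Uniqueness of roots in uniform groups *)

(** If distinct [a] and [b] had the same image, [A] without [a] would still map onto [B], against
    the count. *)
Lemma finite_card_surj_inj (T T' : choiceType) (A : set T) (B : set T')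
    (f : T -> T') :
  finite_set A -> A #= B -> B `<=` f @` A -> {in A &, injective f}.
Proof.
move=> finA AB Bf a b; rewrite !inE => Aa Ab fab; apply: contrapT => ab.
have BA : B #<= A `\ a.
  apply: card_le_trans (card_image_le f (A `\ a)); apply: subset_card_le.
  move=> y /Bf[c Ac <-]; have [->|ca] := pselect (c = a); last by exists c.
  by exists b => //; split=> // /esym.
have [m Am] := (finite_setP A).1 finA.
have finAa : finite_set (A `\ a) := finite_setD _ finA.
have : (m <= #|` fset_set (A `\ a)|)%N.
  apply: leq_card_fset_set => //.
  by rewrite -(card_le_eql Am) (card_le_eql AB).
rewrite -(card_fset_set Am) fset_setD1 // [X in (X <= _)%N](cardfsD1 a).
by rewrite in_fset_set // mem_set // ltnn.
Qed.

Section Uniform.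
Variables (p : nat) (U : topologicalGroupType).
Hypotheses (p_prime : prime p) (pro_pU : pro_p p U) (unifU : uniform p U).
Implicit Types (N K : set U) (x y z w : U) (n : nat).

Local Notation L n := (@lower_p_series p U n.+1).

Let nL n : normal_subgroup (L n) := lower_p_series_normal p U n.
Let sL n : subgroup (L n) := (nL n).1.

(** Uniformity reduces this to $U/P_2(U)$, which is abelian of exponent dividing [p] and
    topologically finitely generated. *)
Lemma lcosets_lower_p_series_finite n : finite_set (lcosets (L n) (L n.+1)).
Proof.
have [tfg _ /(_ n.+1 isT) idx] := unifU.
rewrite (eq_finite_set idx); apply: (tfg_finite_index (prime_gt0 p_prime)) tfg.
- exact: nL 1%N.
- exact: lower_p_series_closed.
- by move=> x y; exact: (@lower_p_seriesR _ _ 0).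
- by move=> x; exact: (@lower_p_seriesX _ _ 0).
Qed.

Lemma powerfulR x y :
  closure (power_subgroup (if p == 2 then 4 else p) setT) [~ x, y].
Proof.
have [_ pow _] := unifU; apply: quotient_abelianR => //.
by apply: closure_normal; apply: power_subgroup_normal; exact: normal_subgroupT.
Qed.

(** For $p = 2$ the coefficient ['C(2, 2)] in the collection formula gives no factor $p$; this extra
    descent, due to powerfulness, compensates. *)
Lemma lower_2_seriesR n x y : p = 2 -> L n x -> L n.+2 [~ x, y].
Proof.
move=> p2; elim: n x y => [|n IH] x y.
  move=> _; have := @powerfulR x y; rewrite (introT eqP p2).
  apply: closure_min; first exact: lower_p_series_closed.
  apply: generated_min; first exact: sL 2.
  (* A fourth power is a square of a square, so it descends two terms. *)
  move=> _ [z _ <-]; rewrite (expgnA z 2 2) -[in _ ^+ 2]p2.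
  by do 2!apply: lower_p_seriesX.
suff : L n.+1 `<=` [set z | L n.+3 [~ z, y]] by exact.
have clR : closed [set z | L n.+3 [~ z, y]].
  have /continuous_closedP := @continuous_commg _ y; apply.
  exact: lower_p_series_closed.
have sN := sL n.+3; have nN := (nL n.+3).2.
apply: lower_p_series_min => //.
- apply/subgroupP; split=> [|u v /= Lu Lv].
    by rewrite /= comm1g; exact: subgroup1 (sL _).
  rewrite commMgl commVgl; apply: (subgroupM sN); first exact: nN.
  by apply: (subgroupV sN); apply: nN.
(* Collection makes [[~ z ^+ 2, y]] congruent to [[~ z, y] ^+ 2], which lies in [L n.+3]. *)
- move=> z /(IH _ y) Lc /=.
  rewrite [in _ ^+ p]p2 commgEl conjXg (conjg_commg z y).
  have := @eqmod_expMg _ _ (nL n.+3) z [~ z, y] 2; rewrite binn expg1 => powM.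
  apply: (eqmod_trans (nL n.+3) (eqmodMgr (z ^+ 2) (y := [~ z, y] ^+ 2) _)).
    by rewrite -[in _ ^+ 2]p2; apply: lower_p_seriesX.
  apply: (eqmod_sym (nL n.+3)).
  apply: powM => [u|]; last exact: lower_p_seriesR.
  by apply: lower_p_seriesR; apply: lower_p_series_decr; exact: lower_p_seriesR.
- by move=> z w /(IH _ w) Lc /=; exact: lower_p_seriesR.
Qed.

(** The error term is [[~ z, x] ^+ 'C(p, 2)]. For odd [p] the binomial is divisible by [p]; for $p =
    2$ the commutator itself already lies two terms down. *)
Lemma eqmod_expgp n x z : L n z ->
  eqmod (L n.+2) ((x * z) ^+ p) (x ^+ p * z ^+ p).
Proof.
move=> Lz; apply: (eqmod_expMg (nL n.+2)) => [u|].
  by do 2!apply: lower_p_seriesR.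
have [p2|podd] := eqVneq p 2.
  by rewrite p2 binn expg1 -p2; exact: lower_2_seriesR.
have /dvdnP[k ->] : p %| 'C(p, 2).
  by rewrite prime_dvd_bin //= ltn_neqAle eq_sym podd prime_gt1.
rewrite mulnC expgnA; apply: (subgroupX _ (sL _)).
by apply: lower_p_seriesX; exact: lower_p_seriesR.
Qed.

(** As [[~ w ^+ p, y]] is congruent to [[~ w, y] ^+ p], commutation with [y] turns an approximate
    root of [x] into one of [[~ x, y]], one term further down. *)
Lemma commg_root n x y w : L n w -> L n.+1 x -> eqmod (L n.+2) (w ^+ p) x ->
  eqmod (L n.+3) ([~ w, y] ^+ p) [~ x, y].
Proof.
move=> Lw Lx wx; have [u Lu ->] : exists2 u, L n.+2 u & x = w ^+ p * u.
  by exists ((w ^+ p)^-1 * x); rewrite ?mulVKg.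
have Ec : eqmod (L n.+3) ([~ w, y] ^+ p) [~ w ^+ p, y].
  rewrite (commgEl (w ^+ p)) conjXg (conjg_commg w y).
  have := eqmodMl (w ^- p) (eqmod_expgp (x := w) (lower_p_seriesR (y := y) Lw)).
  by rewrite mulKg; exact: (eqmod_sym (nL _)).
apply: (eqmod_trans (nL _) Ec); rewrite commMgl conjg_commg.
rewrite -mulgA; apply: (eqmodMgr (N := L n.+3)).
apply: (subgroupM (sL n.+3)); last exact: lower_p_seriesR.
by rewrite -invgR; apply: (subgroupV (sL _)); exact: lower_p_seriesR.
Qed.

(** The elements with such a root form a closed subgroup, so it suffices to treat $p$-th powers and
    commutators. *)
Lemma lower_p_series_root n x : L n.+1 x ->
  exists2 w, L n w & eqmod (L n.+2) (w ^+ p) x.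
Proof.
pose S n := [set x | L n.+1 x /\ exists2 w, L n w & eqmod (L n.+2) (w ^+ p) x].
suff : L n.+1 `<=` S n by move=> LS /LS[].
have sS m : subgroup (S m).
  apply/subgroupP; split=> [|u v [Lu [w Lw wu]] [Lv [z Lz zv]]].
    split; first exact: subgroup1 (sL _).
    exists 1; first exact: subgroup1 (sL _).
    by rewrite expg1n; exact: (eqmod_refl (nL _)).
  split; first by apply: (subgroupM (sL _)) => //; exact: (subgroupV (sL _)).
  exists (w * z^-1).
    by apply: (subgroupM (sL _)) => //; exact: (subgroupV (sL _)).
  apply: (eqmod_trans (nL _) (eqmod_expgp (subgroupV (sL m) Lz))).
  apply: (eqmod_trans (nL _) (eqmodMr (nL _) _ wu)); rewrite expVgn.
  by apply: (eqmodMl (N := L m.+2)); exact: (eqmodV (nL _)).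
have S_X m z : L m z -> S m (z ^+ p).
  move=> Lz; split; first exact: lower_p_seriesX.
  by exists z => //; exact: (eqmod_refl (nL _)).
(* [S m] is a finite union of cosets of the closed subgroup [L m.+2]. *)
have cS m : closed (S m).
  apply: (@finite_index_closed _ _ (L m.+2)) => //.
  - move=> z Lz; split; first exact: lower_p_series_decr.
    by exists 1; [exact: subgroup1 (sL _) | rewrite expg1n eqmod1].
  - exact: lower_p_series_closed.
  - apply: sub_finite_set (lcosets_lower_p_series_finite m.+1).
    by apply: lcosets_sub => z [].
elim: n {x} => [|n IH]; apply: lower_p_series_min => //.
- exact: S_X.
(* In the base case powerfulness puts the commutators in the closed subgroup generated by $p$-th
   powers, or by fourth powers, which are squares too. *)
- move=> x y _; have := @powerfulR x y.
  apply: closure_min => //; apply: generated_min => // _ [z _ <-].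
  case: ifP => [/eqP p2|_]; last exact: S_X.
  by rewrite (expgnA z 2 2) -p2; apply: S_X.
- exact: S_X.
- move=> x y Lx; split; first exact: lower_p_seriesR.
  have [_ [w Lw wx]] := IH _ Lx.
  by exists [~ w, y]; [exact: lower_p_seriesR | exact: commg_root].
Qed.

(** Taking $p$-th powers maps $P_{n+1}/P_{n+2}$ onto $P_{n+2}/P_{n+3}$. Both are finite of the same
    size, so the map is injective, and [w] has the same image as [1]. *)
Lemma lower_p_seriesX_inj n w : L n w -> L n.+2 (w ^+ p) -> L n.+1 w.
Proof.
move=> Lw Lwp.
(* The default [1] is returned only for sets that are not the coset of an element of [L n]. *)
pose rep (C : set U) := xget 1 [set x | L n x /\ mulset [set x] (L n.+1) = C].
pose f C := mulset [set rep C ^+ p] (L n.+2).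
(* By the congruence for $p$-th powers, [f] does not depend on the chosen representative. *)
have fE x : L n x -> f (mulset [set x] (L n.+1)) = mulset [set x ^+ p] (L n.+2).
  move=> Lx; rewrite /f /rep.
  case: xgetP => [z _ [Lz /eq_coset-/(_ (sL _)) zx]|].
    apply/(eq_coset _ _ (sL _)); rewrite -[in x ^+ p](mulVKg z x).
    apply: (eqmod_sym (nL n.+2)).
    have := eqmod_expgp (x := z) (lower_p_series_decr zx).
    move=> /(eqmod_trans (nL n.+2)); apply; apply: (eqmod_sym (nL n.+2)).
    by apply: (eqmodMgr (N := L n.+2)); exact: lower_p_seriesX.
  by move=> /(_ x) [].
have idx : lcosets (L n) (L n.+1) #= lcosets (L n.+1) (L n.+2).
  have [_ _ idx] := unifU; apply: card_eq_trans (idx n.+1 isT) _.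
  by rewrite card_eq_sym; exact: (idx n.+2 isT).
have f_surj : lcosets (L n.+1) (L n.+2) `<=` f @` lcosets (L n) (L n.+1).
  move=> _ [y /lower_p_series_root[x Lx xy] <-].
  exists (mulset [set x] (L n.+1)); first by exists x.
  by rewrite fE //; apply/(eq_coset _ _ (sL _)).
have f_inj := finite_card_surj_inj (lcosets_lower_p_series_finite n) idx f_surj.
have /(eq_coset _ _ (sL _)) : mulset [set 1] (L n.+1) = mulset [set w] (L n.+1).
  apply: f_inj; rewrite ?inE; [|by exists w|].
    by exists 1 => //; exact: subgroup1 (sL _).
  rewrite !fE //; last exact: subgroup1 (sL _).
  by apply/(eq_coset _ _ (sL _)); rewrite expg1n invg1 mul1g.
by rewrite invg1 mul1g.
Qed.

Lemma expgp_inj : injective (fun x : U => x ^+ p).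
Proof.
move=> x y /= exy.
suff /(congr1 (mulg x)) : x^-1 * y = 1 by rewrite mulVKg mulg1.
apply: (open_normal_separates pro_pU) => N nN oN.
have [n] := lower_p_series_sub_open p_prime pro_pU nN oN; apply.
elim: n => [//|n IH]; apply: lower_p_seriesX_inj => //.
by have := eqmod_expgp (x := x) IH; rewrite /eqmod mulVKg exy mulKg.
Qed.

Lemma expg_inj n : (0 < n)%N -> injective (fun x : U => x ^+ n).
Proof.
move=> n0; have [m pm ->] := pfactor_coprime p_prime n0.
elim: (logn p n) => [|k IH] x y /=.
  by rewrite expn0 muln1; exact: (expg_coprime_inj pro_pU pm).
by rewrite expnSr mulnA !(expgnA _ (m * p ^ k)) => /expgp_inj/IH.
Qed.

End Uniform.

(** * From commuting powers to commuting elements *)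

Theorem theorem2p4 (p : nat) (U : topologicalGroupType) (G : set U) :
  prime p -> pro_p p U -> uniform p U -> subgroup G ->
  virtually_abelian G -> abelian G.
Proof.
move=> p_prime pro_pU unifU sG [A [sA _ abA finGA]].
have root_commute (x y : U) n : (0 < n)%N -> commute (x ^+ n) y -> commute x y.
  move=> n0 cxy; apply/commgP; rewrite -conjg_fix; apply/eqP.
  apply: (expg_inj p_prime pro_pU unifU n0); rewrite /= -conjXg.
  by apply/eqP; rewrite conjg_fix; exact/commgP.
move=> x y Gx Gy.
have [n n0 Axn] := finite_index_expn sA sG finGA Gx.
have [m m0 Aym] := finite_index_expn sA sG finGA Gy.
(* The exponents are removed one at a time, from the commuting elements [x ^+ n] and [y ^+ m] of
   [A]. *)
apply: (root_commute _ _ n n0); apply: commute_sym.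
apply: (root_commute _ _ m m0).
by apply: abA.
Qed.
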